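(* Every nice nilpotent Lie algebra $(\mathfrak{g},\mathcal{B})$ of dimension at most $7$ has an arrow-breaking involution, except (up to equivalence) the $6$-dimensional nice Lie algebra \[(0,0,-e^{12},e^{13},e^{14}+e^{23},e^{25}+e^{34}),\] which has none.
   Context: Lie algebras are real and finite-dimensional. A basis $\mathcal{B}=\{e_1,\dots,e_n\}$ of a Lie algebra $\mathfrak{g}$, with dual basis $\{e^1,\dots,e^n\}$, is nice if each $[e_i,e_j]$ is a multiple of a single basis element $e_k$ depending on $i,j$, and each interior product $e_i\lrcorner de^j$ (where $d$ is the Chevalley--Eilenberg differential, $de^j(x,y)=-e^j([x,y])$) is a multiple of a single $e^h$ depending on $i,j$. A nice nilpotent Lie algebra is a pair $(\mathfrak{g},\mathcal{B})$ of a nilpotent Lie algebra and a nice basis; $(\mathfrak{g},\mathcal{B})$ and $(\mathfrak{g}',\mathcal{B}')$ are equivalent if there is a Lie algebra isomorphism $\mathfrak{g}\cong\mathfrak{g}'$ mapping basis elements to multiples of basis elements. The nice diagram of $(\mathfrak{g},\mathcal{B})$ is the directed graph with set of nodes $\mathcal{B}$ and labeled arrows, where $x\xrightarrow{y}z$ is an arrow with source $x$, destination $z$ and label $y$ if and only if $[x,y]$ is a nonzero multiple of $z$. An arrow-breaking involution of $(\mathfrak{g},\mathcal{B})$ is a permutation $\sigma$ of $\mathcal{B}$ with $\sigma\circ\sigma=\mathrm{id}$ such that: (1) whenever $x$ has an incoming arrow with label $y$, then $\sigma(x)$ does not have an incoming arrow with label $\sigma(y)$; (2) whenever $x$ has an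 outgoing arrow with label $y$, then $\sigma(x)$ does not have an outgoing arrow with label $\sigma(y)$. The notation $(0,0,-e^{12},e^{13},e^{14}+e^{23},e^{25}+e^{34})$ lists $de^1,\dots,de^6$ for the dual basis of the nice basis $\{e_1,\dots,e_6\}$, with $e^{ij}=e^i\wedge e^j$. *)

(* Defs.v *)
From mathcomp Require Import all_boot all_order all_algebra all_fingroup.
From mathcomp Require Export reals.

Set Implicit Arguments.
Unset Strict Implicit.
Unset Printing Implicit Defensive.

Import GRing.Theory.
Local Open Scope ring_scope.

Section NiceLie.
Variables (R : realType) (V : vectType R) (br : V -> V -> V).

Record lie_bracket : Prop := LieBracket {
  lie_linear_l : forall y, linear (br^~ y);
  lie_linear_r : forall x, linear (br x);
  lie_alternating : forall x, br x x = 0;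
  lie_jacobi : forall x y z,
    br x (br y z) + br y (br z x) + br z (br x y) = 0 }.

(* Spanned by brackets of basis vectors, as [prodv] in falgebra.v; by
   bilinearity this is the span of all [br u w], u \in U, w \in W. *)
Definition brv (U W : {vspace V}) : {vspace V} :=
  <<[seq br u w | u <- vbasis U, w <- vbasis W]>>%VS.

Fixpoint lower_central (k : nat) : {vspace V} :=
  if k is k'.+1 then brv fullv (lower_central k') else fullv.

Definition nilpotent_bracket : Prop := exists k, lower_central k = 0%VS.

Definition chevalley_eilenberg (alpha : V -> R) : V -> V -> R :=
  fun x y => - alpha (br x y).

Definition interior (x : V) (omega : V -> V -> R) : V -> R := omega x.

Variables (n : nat) (B : n.-tuple V).

(* When [B] is a basis, [coord B j] is the element e^j of the dual basis. *)
Record nice_basis : Prop := NiceBasis {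
  nice_is_basis : basis_of fullv B;
  nice_br : forall i j : 'I_n, exists (k : 'I_n) (a : R),
    br (tnth B i) (tnth B j) = a *: tnth B k;
  nice_d : forall i j : 'I_n, exists (h : 'I_n) (a : R),
    forall v, interior (tnth B i) (chevalley_eilenberg (coord B j)) v
              = a * coord B h v }.

Record nice_nilpotent : Prop := NiceNilpotent {
  nn_lie : lie_bracket;
  nn_nilpotent : nilpotent_bracket;
  nn_nice : nice_basis }.

(* Nodes are indices of basis elements: source [x], label [y],
   destination [z]. *)
Definition arrow (x y z : 'I_n) : Prop :=
  exists2 c : R, c != 0 & br (tnth B x) (tnth B y) = c *: tnth B z.

Definition has_incoming (x y : 'I_n) : Prop := exists w, arrow w y x.
Definition has_outgoing (x y : 'I_n) : Prop := exists z, arrow x y z.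

Record arrow_breaking (s : {perm 'I_n}) : Prop := ArrowBreaking {
  ab_involution : forall x, s (s x) = x;
  ab_incoming : forall x y, has_incoming x y -> ~ has_incoming (s x) (s y);
  ab_outgoing : forall x y, has_outgoing x y -> ~ has_outgoing (s x) (s y) }.

End NiceLie.

Definition nice_equivalent (R : realType)
    (V : vectType R) (br : V -> V -> V) (n : nat) (B : n.-tuple V)
    (V' : vectType R) (br' : V' -> V' -> V') (n' : nat) (B' : n'.-tuple V')
    : Prop :=
  exists f : 'Hom(V, V'),
    [/\ bijective f,
        forall x y, f (br x y) = br' (f x) (f y)
      & forall i, exists j a, f (tnth B i) = a *: tnth B' j].

Section Exceptional.
Variable R : realType.

(* e^{ij} = e^i /\ e^j for 1 <= i, j <= 6, normalized so that
   e^{ij}(e_i, e_j) = 1. *)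
Definition wedge6 (i j : nat) (x y : 'rV[R]_6) : R :=
  x 0 (inord i.-1) * y 0 (inord j.-1) - x 0 (inord j.-1) * y 0 (inord i.-1).

(* (de^1, ..., de^6) evaluated at (x, y). *)
Definition exc_d (x y : 'rV[R]_6) : seq R :=
  [:: 0; 0; - wedge6 1 2 x y; wedge6 1 3 x y;
      wedge6 1 4 x y + wedge6 2 3 x y;
      wedge6 2 5 x y + wedge6 3 4 x y].

(* de^k(x, y) = - e^k([x, y]). *)
Definition exc_bracket (x y : 'rV[R]_6) : 'rV[R]_6 :=
  \row_(k < 6) - (exc_d x y)`_k.

Definition exc_basis : 6.-tuple 'rV[R]_6 := [tuple delta_mx 0 i | i < 6].

End Exceptional.

(* Main.v *)
(* Number the nodes of the diagram 1, ..., n so that every arrow lowers the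
   number; depth in the lower central series provides such a numbering.  The
   diagram becomes a table of targets, 0 standing for a vanishing bracket.
   Niceness bounds the number of tables, and the Jacobi identity forces every
   nonzero double bracket to share its target with another term of the cyclic
   sum.  The resulting tables are enumerated (6894 of them for n = 7).  Each
   admits an involution from a short list, except two labelings of the
   exceptional diagram (n = 6) and four tables for n = 7.  The latter contain
     12 -> 3, 13 -> 4, 14 -> 5, 16 -> 7, 25 -> 6, 34 -> 6, 35 -> 7,
   and with structure constants a, b, c, d, g, f, h in this order, the Jacobi
   identity on the triples 125, 134, 124 reads gd = ah, fd = ch, cg = -af,
   whence 2cgd = 0.  On the exceptional diagram the Jacobi identity amounts to
   one relation between the structure constants, and rescaling the basis
   normalizes all of them. *)
From HB Require Import structures.
Require Import Defs.
From mathcomp Require Import all_boot all_order all_algebra all_fingroup.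
From mathcomp Require Import ring.

Set Implicit Arguments.
Unset Strict Implicit.
Unset Printing Implicit Defensive.

Import GRing.Theory Num.Theory.

(** * Tables of targets and their exhaustive enumeration *)

(* Row x of a table lists the targets of [x, y] for y < x; out-of-range reads
   give 0, which accounts for [x, x] = 0. *)
Definition target (D : seq (seq nat)) (x y : nat) : nat :=
  nth 0 (nth [::] D (maxn x y)) (minn x y).

(** The first [j] entries of a row for the new node [size D]. A nonzero target must be smaller than
    [j'], must not occur earlier in the row, and must not be reached from [j'] by an older label:
    the last two conditions come from the single-term interior products. *)
Fixpoint rows (D : seq (seq nat)) (j : nat) : seq (seq nat) :=
  if j is j'.+1 then
    [seq rcons r v | r <- rows D j', v <- [seq v <- iota 0 (maxn j' 1) |
       (v == 0) || (v \notin r) && all (fun h => target D j' h != v) (iota 0 (size D))]]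
  else [:: [::]].

(** Necessary for nonzero multiples of the nodes [a], [b], [c] to sum to zero, node 0 being the zero
    vector: no nonzero node occurs just once. *)
Definition balanced (a b c : nat) : bool :=
  [&& (a == 0) || (a == b) || (a == c),
      (b == 0) || (b == c) || (b == a) & (c == 0) || (c == a) || (c == b)].

Definition jacobi_at (D : seq (seq nat)) (x y z : nat) : bool :=
  balanced (target D x (target D y z)) (target D y (target D z x))
           (target D z (target D x y)).

(* Nodes up to x span an ideal, so the Jacobi condition on triples with largest
   node x is already decided when row x is appended. *)
Definition jacobi_row (D : seq (seq nat)) (x : nat) : bool :=
  all (fun y => all (jacobi_at D x y) (iota 0 y)) (iota 0 x).

Fixpoint diagrams (n : nat) : seq (seq (seq nat)) :=
  if n is n'.+1 then
    [seq rcons D r | D <- diagrams n',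
       r <- [seq r <- rows D n' | jacobi_row (rcons D r) n']]
  else [:: [::]].

Definition table (m : nat -> nat -> nat) (n : nat) : seq (seq nat) :=
  mkseq (fun i => mkseq (m i) i) n.

(** Combinatorial shadow of a nice nilpotent algebra. [target_lt] reflects the numbering that
    nilpotency provides, [target_inj] the condition on interior products, [target_jacobi] the Jacobi
    identity. *)
Record nice_target (m : nat -> nat -> nat) : Prop := NiceTarget {
  targetC : forall x y, m x y = m y x;
  targetxx : forall x, m x x = 0;
  target0 : forall x, m x 0 = 0;
  target_lt : forall x y, 0 < y -> m x y < y;
  target_inj : forall x y z, m x y = m x z -> m x y != 0 -> y = z;
  target_jacobi : forall x y z,
    balanced (m x (m y z)) (m y (m z x)) (m z (m x y)) }.

Section Completeness.
Variable m : nat -> nat -> nat.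
Hypothesis mP : nice_target m.

Lemma target_table n x y : x < n -> y < n -> target (table m n) x y = m x y.
Proof.
move=> xn yn; rewrite /target /table nth_mkseq ?gtn_max ?xn //.
case: (ltngtP x y) => [xy|yx|->].
- by rewrite nth_mkseq // (targetC mP).
- by rewrite nth_mkseq.
- by rewrite nth_default ?size_mkseq // (targetxx mP).
Qed.

Lemma target_small n x y : x < n -> y < n -> m x y < n.
Proof.
move=> xn yn; case: y yn => [|y] yn; first by rewrite (target0 mP) (leq_ltn_trans _ xn).
by apply: leq_trans (ltnW yn); rewrite (target_lt mP).
Qed.

Lemma row_complete n j : j <= n -> mkseq (m n) j \in rows (table m n) j.
Proof.
elim: j => [|j IH] jn //=; rewrite mkseqS.
apply/allpairsPdep; exists (mkseq (m n) j), (m n j); split=> //; first exact/IH/ltnW.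
rewrite mem_filter mem_iota /= add0n; apply/andP; split.
  case: eqVneq => //= m0; apply/andP; split.
    apply/mapP => -[k]; rewrite mem_iota /= add0n => kj /(target_inj mP) /(_ m0) jk.
    by rewrite jk ltnn in kj.
  (* Equal nonzero targets from [j] with labels [h < n] and [n] would contradict injectivity. *)
  apply/allP => h; rewrite mem_iota size_mkseq /= add0n => hn.
  rewrite target_table //; apply/eqP => mE.
  have := target_inj mP (x := j) (y := h) (z := n).
  by rewrite mE (targetC mP j n) => /(_ erefl m0) E; rewrite E ltnn in hn.
case: j jn {IH} => [|j] jn; first by rewrite (target0 mP).
by rewrite leq_max (target_lt mP).
Qed.

(** Each new row of [table m n.+1] passes every test of the search; since targets decrease, the
    Jacobi tests read only inside the table. *)
Lemma diagrams_complete n : table m n \in diagrams n.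
Proof.
elim: n => [|n IH] //=.
rewrite {1}/table mkseqS; apply/allpairsPdep.
exists (table m n), (mkseq (m n) n); split=> //.
rewrite mem_filter row_complete // andbT -[rcons _ _]/(rcons (mkseq _ _) _).
rewrite -(mkseqS (fun i => mkseq (m i) i)) -/(table m n.+1).
apply/allP => x; rewrite mem_iota /= add0n => xn.
apply/allP => y; rewrite mem_iota /= add0n => yx.
have [xn' yn'] : x < n.+1 /\ y < n.+1 by rewrite !ltnS (ltnW xn) (ltnW (ltn_trans yx xn)).
have s := target_small (n := n.+1).
by rewrite /jacobi_at !target_table ?s //; exact: (target_jacobi mP).
Qed.
End Completeness.

(** * Deciding the arrow-breaking condition by computation *)

Definition image (s : seq nat) (x : nat) : nat := nth 0 (0 :: s) x.

Definition outgoing (D : seq (seq nat)) (n : nat) : seq (nat * nat) :=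
  [seq p <- [seq (x, y) | x <- iota 1 n, y <- iota 1 n] | target D p.1 p.2 != 0].

Definition incoming (D : seq (seq nat)) (n : nat) : seq (nat * nat) :=
  [seq (target D p.1 p.2, p.2) | p <- outgoing D n].

Definition displaced (s : seq nat) (l : seq (nat * nat)) : bool :=
  all (fun p => (image s p.1, image s p.2) \notin l) l.

Definition involutive_on (n : nat) (s : seq nat) : bool :=
  all (fun x => (image s x \in iota 1 n) && (image s (image s x) == x)) (iota 1 n).

Definition diagram_breaking (D : seq (seq nat)) (n : nat) (s : seq nat) : bool :=
  [&& involutive_on n s, displaced s (outgoing D n) & displaced s (incoming D n)].

(* A greedy set cover over all involutions of 1, ..., n; an involution s is
   given as the sequence of its values. *)
Definition candidates (n : nat) : seq (seq nat) := nth [::] [::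
  [:: [::]];
  [:: [:: 1]];
  [:: [:: 1; 2]];
  [:: [:: 2; 1; 3]];
  [:: [:: 3; 4; 1; 2];
      [:: 4; 3; 2; 1]];
  [:: [:: 4; 3; 2; 1; 5];
      [:: 3; 4; 1; 2; 5];
      [:: 5; 3; 2; 4; 1]];
  [:: [:: 5; 6; 4; 3; 1; 2];
      [:: 5; 4; 6; 2; 1; 3];
      [:: 6; 4; 5; 2; 3; 1];
      [:: 6; 5; 4; 3; 2; 1];
      [:: 4; 5; 6; 1; 2; 3];
      [:: 6; 3; 2; 5; 4; 1];
      [:: 5; 3; 2; 6; 1; 4];
      [:: 5; 4; 3; 2; 1; 6];
      [:: 4; 6; 5; 1; 3; 2];
      [:: 6; 4; 3; 2; 5; 1]];
  [:: [:: 6; 7; 5; 4; 3; 1; 2];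
      [:: 6; 5; 7; 4; 2; 1; 3];
      [:: 7; 5; 6; 4; 2; 3; 1];
      [:: 7; 6; 5; 4; 3; 2; 1];
      [:: 5; 6; 7; 4; 1; 2; 3];
      [:: 6; 7; 3; 5; 4; 1; 2];
      [:: 7; 6; 3; 5; 4; 2; 1];
      [:: 5; 7; 6; 4; 1; 3; 2];
      [:: 6; 4; 7; 2; 5; 1; 3];
      [:: 7; 4; 6; 2; 5; 3; 1]]
  ] n.

(* Node x stands for e_(7 - x). *)
Definition exceptional_diagram : seq (seq nat) :=
  [:: [::]; [:: 0]; [:: 0; 0]; [:: 0; 0; 0]; [:: 0; 0; 0; 1];
      [:: 0; 0; 1; 0; 2]; [:: 0; 0; 0; 2; 3; 4]].

(** The same diagram with the nodes of e_1 and e_2 exchanged; neither has an incoming arrow, so both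
    numberings decrease along arrows. *)
Definition exceptional_diagram_swapped : seq (seq nat) :=
  [:: [::]; [:: 0]; [:: 0; 0]; [:: 0; 0; 0]; [:: 0; 0; 0; 1];
      [:: 0; 0; 0; 2; 3]; [:: 0; 0; 1; 0; 2; 4]].

(* Nodes 5, 4, 3, 2, 1 stand for e_3, ..., e_7, and x1, x2 for e_1, e_2 in
   either order. *)
Definition obstructed (m : nat -> nat -> nat) (x1 x2 : nat) : bool :=
  [seq m p.1 p.2 | p <- [:: (x1, x2); (x1, 5); (x1, 4); (x1, 2); (x2, 3);
     (5, 4); (5, 3); (x1, 3); (x2, 4)]] == [:: 5; 4; 3; 1; 2; 2; 1; 0; 0].

(** Involutivity does not depend on the table, so it is left to [candidates_involutive] and only the
    displacement conditions are tested for each table. *)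
Definition diagram_settled (n : nat) (D : seq (seq nat)) : bool :=
  [|| (let out := outgoing D n in let inc := incoming D n in
       has (fun s => displaced s out && displaced s inc) (candidates n)),
      (n == 6) && (D \in [:: exceptional_diagram; exceptional_diagram_swapped])
    | (n == 7) && (obstructed (target D) 7 6 || obstructed (target D) 6 7)].

Lemma all_iota0 (P : pred nat) n : all P (iota 0 n) -> forall x, x < n -> P x.
Proof. by move=> /allP PP x xn; apply: PP; rewrite mem_iota. Qed.

Lemma candidates_involutive n : n <= 7 -> all (involutive_on n) (candidates n).
Proof.
move: n; apply: (@all_iota0 (fun n => all (involutive_on n) (candidates n)) 8); vm_compute; reflexivity.
Qed.

(** By computation over the whole enumeration; [n.+1] rows account for the [n] nodes and the dummy
    node 0. *)
Lemma diagrams_settled n : n <= 7 -> all (diagram_settled n) (diagrams n.+1).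
Proof.
move: n; apply: (@all_iota0 (fun n => all (diagram_settled n) (diagrams n.+1)) 8); vm_compute; reflexivity.
Qed.

(** A negative statement needs all 720 permutations, not just the short list of candidates. *)
Lemma exceptional_unbroken s :
  perm_eq s (iota 1 6) -> ~~ diagram_breaking exceptional_diagram 6 s.
Proof.
rewrite -mem_permutations; apply/allP: s; vm_compute; reflexivity.
Qed.

Local Open Scope ring_scope.

(** * Linear maps and coordinates on a basis *)

Section Linear.
Variables (R : realType) (V : vectType R).

Lemma linear_fun_sum (W : lmodType R) (g : V -> W) (I : finType) (a : I -> R) (v : I -> V) :
  linear g -> g (\sum_i a i *: v i) = \sum_i a i *: g (v i).
Proof.
(* The bare function is packaged as a linear map so that the general lemmas on linear maps apply. *)
move=> glin; pose G : {linear V -> W} := HB.pack g (GRing.isLinear.Build _ _ _ _ g glin).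
by rewrite -[g]/(G : V -> W) linear_sum; apply: eq_bigr => i _; rewrite linearZ.
Qed.

Lemma linear_fun0 (W : lmodType R) (g : V -> W) : linear g -> g 0 = 0.
Proof.
move=> glin; pose G : {linear V -> W} := HB.pack g (GRing.isLinear.Build _ _ _ _ g glin).
by rewrite -[g]/(G : V -> W) linear0.
Qed.

Lemma linear_funZ (W : lmodType R) (g : V -> W) a v : linear g -> g (a *: v) = a *: g v.
Proof.
move=> glin; pose G : {linear V -> W} := HB.pack g (GRing.isLinear.Build _ _ _ _ g glin).
by rewrite -[g]/(G : V -> W) linearZ.
Qed.

Variables (n : nat) (B : n.-tuple V).
Hypothesis Bbasis : basis_of fullv B.

Lemma basis_sum v : v = \sum_i coord B i v *: tnth B i.
Proof.
rewrite {1}(coord_basis Bbasis (memvf v)).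
by apply: eq_bigr => i _; rewrite (tnth_nth 0).
Qed.

Lemma linear_fun_ext (W : lmodType R) (g h : V -> W) :
  linear g -> linear h -> (forall i, g (tnth B i) = h (tnth B i)) -> g =1 h.
Proof.
move=> glin hlin gh v; rewrite (basis_sum v) !linear_fun_sum //.
by apply: eq_bigr => i _; rewrite gh.
Qed.

Lemma bilinear_fun_ext (W : lmodType R) (g h : V -> V -> W) :
  (forall y, linear (g^~ y)) -> (forall x, linear (g x)) ->
  (forall y, linear (h^~ y)) -> (forall x, linear (h x)) ->
  (forall i j, g (tnth B i) (tnth B j) = h (tnth B i) (tnth B j)) ->
  forall x y, g x y = h x y.
Proof.
move=> gl gr hl hr gh x; apply: linear_fun_ext => // i.
by apply: (linear_fun_ext (g := g^~ _) (h := h^~ _)).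
Qed.

Lemma coord_tnth (i j : 'I_n) : coord B i (tnth B j) = (i == j)%:R.
Proof. by rewrite (tnth_nth 0) coord_free ?(basis_free Bbasis)// eq_sym. Qed.

Lemma tnth_basis_neq0 i : tnth B i != 0.
Proof.
apply/eqP => B0; have := coord_tnth i i.
by rewrite B0 linear0 eqxx => /esym/eqP; rewrite oner_eq0.
Qed.

End Linear.

(** * Bracket calculus and the lower central series *)

Section Bracket.
Variables (R : realType) (V : vectType R) (br : V -> V -> V).
Hypothesis brP : lie_bracket br.

Lemma lie0v y : br 0 y = 0.
Proof. exact: (linear_fun0 (g := br^~ y) (lie_linear_l brP y)). Qed.
Lemma liev0 x : br x 0 = 0.
Proof. exact: linear_fun0 (lie_linear_r brP x). Qed.
Lemma lieZv a x y : br (a *: x) y = a *: br x y.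
Proof. exact: (linear_funZ (g := br^~ y) _ _ (lie_linear_l brP y)). Qed.
Lemma lievZ a x y : br x (a *: y) = a *: br x y.
Proof. exact: linear_funZ (lie_linear_r brP x). Qed.
Lemma lieDv x y z : br (x + y) z = br x z + br y z.
Proof. by have := lie_linear_l brP z 1 x y; rewrite !scale1r. Qed.
Lemma lievD x y z : br x (y + z) = br x y + br x z.
Proof. by have := lie_linear_r brP x 1 y z; rewrite !scale1r. Qed.
Lemma lieC x y : br y x = - br x y.
Proof.
have := lie_alternating brP (x + y).
rewrite lieDv !lievD !(lie_alternating brP) add0r addr0 addrC.
by move/eqP; rewrite addr_eq0 => /eqP.
Qed.

Lemma mem_brv (U W : {vspace V}) u w : u \in U -> w \in W -> br u w \in brv br U W.
Proof.
move=> uU wW; rewrite (coord_vbasis uU) (coord_vbasis wW).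
rewrite (linear_fun_sum (g := br^~ _)) //; last exact: (lie_linear_l brP).
apply: memv_suml => i _; apply: memvZ.
rewrite linear_fun_sum //; last exact: (lie_linear_r brP).
apply: memv_suml => j _; apply/memvZ/memv_span.
by apply: allpairs_f; apply: mem_nth; rewrite size_tuple.
Qed.

Lemma brvv0 U : brv br U 0%VS = 0%VS.
Proof.
apply/eqP; rewrite -subv0; apply/span_subvP => v /allpairsP[[u w] /= [_ w0 ->]].
by move: (vbasis_mem w0); rewrite memv0 => /eqP ->; rewrite liev0 mem0v.
Qed.

Lemma lower_central_eq0 k l :
  lower_central br k = 0%VS -> (k <= l)%N -> lower_central br l = 0%VS.
Proof.
move=> k0; elim: l => [|l IH]; first by rewrite leqn0 => /eqP <-.
by rewrite leq_eqVlt => /predU1P[<- //|kl] /=; rewrite IH // brvv0.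
Qed.

End Bracket.

(** * Numbering the basis by depth *)

Section Sorting.
Variables (R : realType) (V : vectType R) (br : V -> V -> V) (n : nat) (B : n.-tuple V).
Hypothesis nn : nice_nilpotent br B.

Let brP := nn_lie nn.

(* The depth of a basis element in the lower central series increases strictly
   along arrows. *)
Lemma sorted_by_depth : exists2 L : seq 'I_n, perm_eq L (enum 'I_n) &
  forall i j k, arrow br B i j k -> (index k L < index j L)%N.
Proof.
have [K LK0] := nn_nilpotent nn; have Bb := nice_is_basis (nn_nice nn).
pose d (i : 'I_n) := (\max_(a < K | tnth B i \in lower_central br a) a)%N.
have dlt i j k : arrow br B i j k -> (d j < d k)%N.
  case=> c c0 brE.
  (* Ensures that the maximum defining [d] ranges over a nonempty set and is attained. *)
  have K0 : (0 < K)%N.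
    rewrite lt0n; apply: contra_neq (tnth_basis_neq0 Bb i) => K0.
    by apply/eqP; rewrite -memv0 -LK0 K0 memvf.
  have [a ja ->] : {a : 'I_K | tnth B j \in lower_central br a & d j = a}.
    by apply: eq_bigmax_cond; apply/card_gt0P; exists (Ordinal K0); apply: memvf.
  have ka : tnth B k \in lower_central br a.+1.
    rewrite -[tnth B k](scalerK c0) -brE memvZ //=.
    by apply: mem_brv => //; rewrite memvf.
  have aK : (a.+1 < K)%N.
    rewrite ltnNge; apply: contra (tnth_basis_neq0 Bb k) => Ka.
    by rewrite -memv0 -(lower_central_eq0 brP LK0 Ka).
  by apply: (leq_bigmax_cond (Ordinal aK)).
(* Deeper elements come first, so that arrows lower the position. *)
pose r := fun i j => (d j <= d i)%N.
have rtot : total r by move=> i j; exact: leq_total.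
have rtr : transitive r by move=> i j k ji ik; exact: leq_trans ik ji.
exists (sort r (enum 'I_n)); first by rewrite perm_sort.
move=> i j k /dlt; apply: contraTT; rewrite -leqNgt -leqNgt => jk.
have mL x : x \in sort r (enum 'I_n) by rewrite mem_sort mem_enum.
exact: (sorted_leq_index rtr (fun x => leqnn _) (sort_sorted rtot _) _ _ (mL j) (mL k) jk).
Qed.

End Sorting.

(** * Nodes as basis vectors, and coordinates along nodes *)

(* L lists the basis indices in the order of the nodes 1, ..., n. *)
Definition node (R : realType) (V : vectType R) n (B : n.-tuple V) (L : seq 'I_n) (x : nat) : V :=
  nth 0 (0 :: [seq tnth B i | i <- L]) x.

Arguments node {R V n} B L x%_N.

(** The scalar can be nonzero even for a vanishing bracket: the target is then 0, and node 0 is the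
    zero vector. *)
Definition coding (R : realType) (V : vectType R) (br : V -> V -> V) n (B : n.-tuple V)
    (D : seq (seq nat)) (L : seq 'I_n) : Prop :=
  forall x y, (x <= n)%N -> (y <= n)%N ->
    (target D x y <= n)%N /\
    exists2 c : R, c != 0 & br (node B L x) (node B L y) = c *: node B L (target D x y).

Section Node.
Variables (R : realType) (V : vectType R) (n : nat) (B : n.-tuple V) (L : seq 'I_n).
Hypotheses (Bb : basis_of fullv B) (Lperm : perm_eq L (enum 'I_n)).

Definition pos (i : 'I_n) : nat := (index i L).+1.

Local Notation e := (node B L).

Lemma mem_order i : i \in L. Proof. by rewrite (perm_mem Lperm) mem_enum. Qed.

Lemma size_order : size L = n.
Proof. by rewrite (perm_size Lperm) size_enum_ord. Qed.

Lemma uniq_order : uniq L. Proof. by rewrite (perm_uniq Lperm) enum_uniq. Qed.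

Lemma pos_le i : (pos i <= n)%N.
Proof. by rewrite -size_order index_mem mem_order. Qed.

Lemma node_pos i : e (pos i) = tnth B i.
Proof. by rewrite /node /= (nth_map i) ?index_mem ?nth_index ?mem_order. Qed.

Lemma pos_inj : injective pos.
Proof. by move=> i j [] /(congr1 (nth i L)); rewrite !nth_index ?mem_order. Qed.

Variant node_spec (x : nat) : Prop :=
| NodeOut of e x = 0 & (x = 0 \/ n < x)%N
| NodePos i of x = pos i.

Lemma nodeP x : node_spec x.
Proof.
case: x => [|x]; first by apply: NodeOut; [|left].
have [nx|xn] := leqP n x.
  by apply: NodeOut; [rewrite /node /= nth_default ?size_map ?size_order | right].
by apply: (NodePos (i := nth (Ordinal xn) L x)); rewrite /pos index_uniq ?uniq_order ?size_order.
Qed.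

(** The sum has at most one term, and none for node 0 or out-of-range nodes, so no index has to be
    chosen for [x]. *)
Definition node_coord (x : nat) (v : V) : R := \sum_(i | pos i == x) coord B i v.

Lemma node_coord_linear x : linear (node_coord x : V -> R^o).
Proof.
move=> a u v; rewrite /node_coord scaler_sumr -big_split /=.
by apply: eq_bigr => i _; rewrite linearP.
Qed.

Lemma node_coordZ x a v : node_coord x (a *: v) = a * node_coord x v.
Proof. exact: (linear_funZ a v (node_coord_linear x)). Qed.

Lemma node_coordD x u v : node_coord x (u + v) = node_coord x u + node_coord x v.
Proof. by rewrite -[u]scale1r node_coord_linear !scale1r. Qed.

Lemma node_coord0 x : node_coord x 0 = 0.
Proof. by rewrite -(scale0r 0) node_coordZ mul0r. Qed.

Lemma node_coord_node x y : (x <= n)%N ->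
  node_coord x (e y) = ((x == y) && (x != 0%N))%:R.
Proof.
move=> xn; case: (nodeP x) => [_ [->|/leq_trans /(_ xn)]|i ->]; last first.
- rewrite /node_coord (big_pred1 i); last by move=> j; rewrite /= (inj_eq pos_inj).
  case: (nodeP y) => [-> [->|ny]|j ->].
  + by rewrite linear0.
  + by rewrite linear0; case: eqVneq => // E; move: (pos_le i); rewrite E leqNgt ny.
  + by rewrite node_pos coord_tnth // (inj_eq pos_inj) andbT.
- by rewrite ltnn.
- by rewrite andbF /node_coord big_pred0.
Qed.

(** Meant for multiples of a basis vector, where at most one coordinate is nonzero; the zero vector
    goes to node 0. *)
Definition vertex (v : V) : nat :=
  if [pick k | coord B k v != 0] is Some k then pos k else 0%N.

Lemma vertex_le v : (vertex v <= n)%N.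
Proof. by rewrite /vertex; case: pickP => // k _; apply: pos_le. Qed.

Lemma vertex_scale a k : vertex (a *: tnth B k) = if a == 0 then 0%N else pos k.
Proof.
rewrite /vertex; case: pickP => [l|K].
  rewrite linearZ /= coord_tnth // mulf_eq0 negb_or pnatr_eq0 eqb0 negbK.
  by case/andP => /negPf -> /eqP ->.
by move: (K k); rewrite linearZ /= coord_tnth // eqxx mulr1; case: eqP.
Qed.

Lemma vertex0 : vertex 0 = 0%N.
Proof. by rewrite /vertex; case: pickP => // k; rewrite linear0 eqxx. Qed.

Lemma scale_vertex a k :
  exists2 c, c != 0 & a *: tnth B k = c *: e (vertex (a *: tnth B k)).
Proof.
rewrite vertex_scale; have [->|a0] := eqVneq a 0.
  by exists 1; rewrite ?oner_eq0 // scale0r scaler0.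
by exists a; rewrite ?node_pos.
Qed.

End Node.

(** * The target function of a nice nilpotent algebra *)

Section Coding.
Variables (R : realType) (V : vectType R) (br : V -> V -> V) (n : nat) (B : n.-tuple V).
Hypothesis nn : nice_nilpotent br B.

Let brP := nn_lie nn.
Let Bb := nice_is_basis (nn_nice nn).

Lemma arrow_coord i j v k : v = br (tnth B i) (tnth B j) -> coord B k v != 0 ->
  arrow br B i j k.
Proof.
move=> ->; have [l [a brE]] := nice_br (nn_nice nn) i j.
rewrite /arrow brE linearZ /= coord_tnth // mulf_eq0 negb_or pnatr_eq0 eqb0 negbK.
by case/andP=> a0 /eqP ->; exists a.
Qed.

Section Order.
Variable L : seq 'I_n.
Hypothesis Lperm : perm_eq L (enum 'I_n).

Local Notation e := (node B L).
Let m x y := vertex B L (br (e x) (e y)).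


Lemma vertex_br x y :
  exists2 c, c != 0 & br (e x) (e y) = c *: e (m x y).
Proof.
rewrite /m; case: (nodeP B Lperm x) => [-> _|i ->].
  by exists 1; rewrite ?oner_eq0 // lie0v // vertex0 scaler0.
case: (nodeP B Lperm y) => [-> _|j ->].
  by exists 1; rewrite ?oner_eq0 // liev0 // vertex0 scaler0.
rewrite !node_pos //; have [k [a ->]] := nice_br (nn_nice nn) i j.
exact: scale_vertex.
Qed.

Lemma vertex_neq0 v : vertex B L v != 0%N ->
  exists2 k, vertex B L v = pos L k & coord B k v != 0.
Proof. by rewrite /vertex; case: pickP => // k vk _; exists k. Qed.

(** If a nonzero [x] differed from [y] and [z], the coordinate of the sum along node [x] would be
    [a], which is nonzero. *)
Lemma vertex_balanced x y z u v w (a b c : R) :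
  (x <= n)%N -> (y <= n)%N -> (z <= n)%N -> a != 0 -> b != 0 -> c != 0 ->
  u = a *: e x -> v = b *: e y -> w = c *: e z -> u + v + w = 0 ->
  balanced x y z.
Proof.
have key x1 x2 x3 (a1 a2 a3 : R) : (x1 <= n)%N -> a1 != 0 ->
    a1 *: e x1 + a2 *: e x2 + a3 *: e x3 = 0 -> [|| x1 == 0, x1 == x2 | x1 == x3]%N.
  move=> x1n a10 E; apply: contraT; rewrite !negb_or => /and3P[x10 x12 x13].
  have := congr1 (node_coord B L x1) E.
  rewrite !node_coordD !node_coordZ // !node_coord_node // eqxx x10 (negPf x12) (negPf x13).
  by rewrite !mulr0 !addr0 mulr1 node_coord0 => /eqP; rewrite (negPf a10).
move=> xn yn zn a0 b0 c0 -> -> -> E; rewrite /balanced -!orbA.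
apply/and3P; split; [apply: key E|..] => //.
- by apply: (key _ _ _ b c a) => //; rewrite addrC addrA.
- by apply: (key _ _ _ c a b) => //; rewrite -addrA addrC.
Qed.

Lemma vertex_nice_target :
  (forall i j k, arrow br B i j k -> (index k L < index j L)%N) -> nice_target m.
Proof.
move=> Ldecr; split.
- move=> x y; rewrite /m (lieC brP) /vertex.
  by congr (if _ is Some k then _ else _); apply: eq_pick => k; rewrite linearN oppr_eq0.
- by move=> x; rewrite /m (lie_alternating brP) vertex0.
- by move=> x; rewrite /m /node /= liev0 // vertex0.
- move=> x y y0; rewrite /m; have [-> //|/vertex_neq0[k -> ]] := eqVneq (vertex B L (br (e x) (e y))) 0%N.
  case: (nodeP B Lperm x) => [-> _|i ->]; first by rewrite lie0v // linear0 eqxx.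
  case: (nodeP B Lperm y) => [-> _|j ->]; first by rewrite liev0 // linear0 eqxx.
  by rewrite !node_pos // => /(arrow_coord erefl) /Ldecr.
- move=> x y z; rewrite /m => yz m0.
  have [k kE] := vertex_neq0 m0; rewrite yz in m0 kE.
  have [k'] := vertex_neq0 m0; rewrite kE => /(pos_inj Lperm) <- {k' m0 kE yz}.
  case: (nodeP B Lperm x) => [-> _|i ->]; first by rewrite lie0v // linear0 eqxx.
  rewrite node_pos //; have [h [a hE]] := nice_d (nn_nice nn) i k.
  (* Since the interior product of e_i with de^k is a multiple of e^h, only the bracket with e_h can
     have a component along e_k. *)
  have only_h u : coord B k (br (tnth B i) (node B L u)) != 0 -> u = pos L h.
    rewrite -oppr_eq0 -[- _]/(interior _ (chevalley_eilenberg br (coord B k)) _) hE.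
    case: (nodeP B Lperm u) => [-> _|j ->]; first by rewrite linear0 mulr0 eqxx.
    by rewrite node_pos // coord_tnth // mulf_eq0 negb_or pnatr_eq0 eqb0 negbK => /andP[_ /eqP ->].
  by move=> /only_h -> /only_h ->.
- move=> x y z.
  (* Double brackets are again nonzero multiples of single nodes, so the three Jacobi terms have the
     shape required by [vertex_balanced]. *)
  have T u v w : exists2 a, a != 0 & br (e u) (br (e v) (e w)) = a *: e (m u (m v w)).
    have [a a0 aE] := vertex_br v w; have [b b0 bE] := vertex_br u (m v w).
    by exists (a * b); rewrite ?mulf_neq0 // aE lievZ // bE scalerA.
  have [a a0 aE] := T x y z; have [b b0 bE] := T y z x; have [c c0 cE] := T z x y.
  by apply: (vertex_balanced _ _ _ a0 b0 c0 aE bE cE (lie_jacobi brP _ _ _)); apply: vertex_le.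
Qed.

Lemma coding_table : nice_target m -> coding br B (table m n.+1) L.
Proof.
move=> mP x y xn yn; rewrite target_table // vertex_le //; split=> //.
exact: vertex_br.
Qed.

End Order.

Lemma nice_coding : exists L m,
  [/\ perm_eq L (enum 'I_n), nice_target m & coding br B (table m n.+1) L].
Proof.
have [L Lperm Ldecr] := sorted_by_depth nn.
have mP := vertex_nice_target Lperm Ldecr.
exists L; eexists; split; [exact: Lperm|exact: mP|exact: coding_table].
Qed.

(** * Passing between involutions of the basis and of the table *)

Section Breaking.
Variables (D : seq (seq nat)) (L : seq 'I_n).
Hypotheses (Lperm : perm_eq L (enum 'I_n)) (DL : coding br B D L).

Lemma arrow_target i j k : arrow br B i j k <-> target D (pos L i) (pos L j) = pos L k.
Proof.
have [tn [c c0]] := DL (pos_le Lperm i) (pos_le Lperm j).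
rewrite /arrow !node_pos // => cE; split.
  case=> a a0 /(congr1 (node_coord B L (pos L k))); rewrite cE.
  rewrite -(node_pos B Lperm k) !node_coordZ // !node_coord_node ?pos_le // eqxx /= mulr1.
  case: eqVneq => [<- //|_ /esym/eqP]; first by rewrite mulr0 (negPf a0).
by move=> tE; exists c; rewrite // cE tE node_pos.
Qed.

Lemma target_pos i j : target D (pos L i) (pos L j) != 0%N ->
  exists k, target D (pos L i) (pos L j) = pos L k.
Proof.
have [tn _] := DL (pos_le Lperm i) (pos_le Lperm j).
case: (nodeP B Lperm (target D (pos L i) (pos L j))) => [_ [-> //|]|k ->].
  by rewrite ltnNge tn.
by exists k.
Qed.

Lemma mem_outgoing i j : reflect (has_outgoing br B i j) ((pos L i, pos L j) \in outgoing D n).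
Proof.
rewrite mem_filter /=; have -> : (pos L i, pos L j) \in [seq (x, y) | x <- iota 1 n, y <- iota 1 n].
  by apply: allpairs_f; rewrite mem_iota /= add1n ltnS pos_le.
rewrite andbT; apply: (iffP idP) => [/target_pos[k /arrow_target]|[k /arrow_target ->]] //.
by exists k.
Qed.

Lemma mem_iota_pos x : x \in iota 1 n -> exists i, x = pos L i.
Proof.
rewrite mem_iota add1n ltnS => /andP[x0 xn].
case: (nodeP B Lperm x) => [_ [x00|]|i ->]; [by rewrite x00 in x0|by rewrite ltnNge xn|by exists i].
Qed.

Lemma outgoingP p : p \in outgoing D n ->
  exists i j, p = (pos L i, pos L j) /\ has_outgoing br B i j.
Proof.
move=> pD; move: (pD); rewrite mem_filter => /andP[_ /allpairsP[[x y] /= [xi yi pE]]].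
have [i iE] := mem_iota_pos xi; have [j jE] := mem_iota_pos yi.
by exists i, j; rewrite pE iE jE; split=> //; apply/mem_outgoing; rewrite -iE -jE -pE.
Qed.

Lemma mem_incoming i j : reflect (has_incoming br B i j) ((pos L i, pos L j) \in incoming D n).
Proof.
apply: (iffP mapP) => [[p /outgoingP[k [l [-> _]]] /= /eqP]|[k kji]].
  rewrite xpair_eqE => /andP[/eqP iE /eqP/(pos_inj Lperm) jl].
  by exists k; apply/arrow_target; rewrite jl -iE.
exists (pos L k, pos L j); first by apply/mem_outgoing; exists i.
by move/arrow_target: kji => /= ->.
Qed.

Lemma incomingP p : p \in incoming D n ->
  exists i j, p = (pos L i, pos L j) /\ has_incoming br B i j.
Proof.
move=> pD; case/mapP: (pD) => q qo pE; have [k [j [qE kj]]] := outgoingP qo.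
move: qo; rewrite qE mem_filter => /andP[/target_pos[i iE] _].
by exists i, j; move: pE; rewrite qE /= iE => ->; split=> //; exists k; apply/arrow_target.
Qed.

Lemma displaced_outgoing (f : 'I_n -> 'I_n) s : (forall i, image s (pos L i) = pos L (f i)) ->
  displaced s (outgoing D n) <->
  forall i j, has_outgoing br B i j -> ~ has_outgoing br B (f i) (f j).
Proof.
move=> sf; split=> [/allP H i j /mem_outgoing/H /=|H].
  by rewrite !sf => /mem_outgoing.
apply/allP => _ /outgoingP[i [j [-> /H]]] /=; rewrite !sf => K.
by apply/mem_outgoing.
Qed.

Lemma displaced_incoming (f : 'I_n -> 'I_n) s : (forall i, image s (pos L i) = pos L (f i)) ->
  displaced s (incoming D n) <->
  forall i j, has_incoming br B i j -> ~ has_incoming br B (f i) (f j).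
Proof.
move=> sf; split=> [/allP H i j /mem_incoming/H /=|H].
  by rewrite !sf => /mem_incoming.
apply/allP => _ /incomingP[i [j [-> /H]]] /=; rewrite !sf => K.
by apply/mem_incoming.
Qed.

Lemma arrow_breaking_of_diagram s :
  diagram_breaking D n s -> exists t : {perm 'I_n}, arrow_breaking br B t.
Proof.
case/and3P=> /allP sI so si.
have posI i : pos L i \in iota 1 n by rewrite mem_iota /= add1n ltnS pos_le.
have /fin_all_exists[f fE] i : exists j, image s (pos L i) = pos L j.
  by case/andP: (sI _ (posI i)) => /mem_iota_pos.
have fK : involutive f.
  by move=> i; apply: (pos_inj Lperm); rewrite -!fE; case/andP: (sI _ (posI i)) => _ /eqP.
exists (perm (inv_inj fK)); split.
- by move=> i; rewrite !permE.
- by move=> i j; rewrite !permE; apply: (displaced_incoming fE).1.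
- by move=> i j; rewrite !permE; apply: (displaced_outgoing fE).1.
Qed.

Lemma diagram_of_arrow_breaking (t : {perm 'I_n}) : arrow_breaking br B t ->
  exists2 s, perm_eq s (iota 1 n) & diagram_breaking D n s.
Proof.
case=> tK ti to.
(* Positions read along [L] are 1, ..., n in order, so listing images along [L] encodes [t] by its
   sequence of values. *)
have posL : [seq pos L i | i <- L] = iota 1 n.
  apply: (@eq_from_nth _ 0%N); rewrite size_map ?size_iota size_order // => x xn.
  rewrite (nth_map (Ordinal xn)) ?size_order // nth_iota // /pos.
  by rewrite index_uniq ?size_order // (uniq_order Lperm).
have sE i : image [seq pos L (t j) | j <- L] (pos L i) = pos L (t i).
  by rewrite /image /= (nth_map i) ?index_mem ?nth_index ?(mem_order Lperm).
exists [seq pos L (t i) | i <- L].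
  rewrite -posL (map_comp (pos L) t); apply: perm_map; apply: uniq_perm.
  - by rewrite (map_inj_uniq perm_inj) (uniq_order Lperm).
  - exact: (uniq_order Lperm).
  - by move=> i; rewrite (mem_order Lperm) -[i]tK map_f // (mem_order Lperm).
apply/and3P; split.
- apply/allP => _ /mem_iota_pos[i ->]; rewrite !sE tK eqxx andbT.
  by rewrite mem_iota /= add1n ltnS pos_le.
- exact: (displaced_outgoing sE).2 to.
- exact: (displaced_incoming sE).2 ti.
Qed.

End Breaking.
End Coding.

(** * Excluding the remaining tables with seven nodes *)

Section Obstruction.
Variables (R : realType) (V : vectType R) (br : V -> V -> V) (B : 7.-tuple V).
Hypothesis nn : nice_nilpotent br B.
Variables (D : seq (seq nat)) (L : seq 'I_7).
Hypotheses (Lperm : perm_eq L (enum 'I_7)) (DL : coding br B D L).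

Let brP := nn_lie nn.
Let Bb := nice_is_basis (nn_nice nn).
Local Notation e := (node B L).

Lemma obstructed_false x1 x2 : (x1 <= 7)%N -> (x2 <= 7)%N ->
  ~~ obstructed (target D) x1 x2.
Proof.
move=> x1n x2n; apply/negP => /eqP[].
have step x y z : target D x y = z -> (x <= 7)%N -> (y <= 7)%N ->
    exists2 c : R, c != 0 & br (e x) (e y) = c *: e z.
  by move=> <- xn yn; have [_] := DL xn yn.
have eq0 z (k : R) : (0 < z <= 7)%N -> k *: e z = 0 -> k = 0.
  case/andP=> z0 zn /(congr1 (node_coord B L z)).
  by rewrite node_coordZ // node_coord_node // eqxx -lt0n z0 mulr1 node_coord0.
move/step=> /(_ x1n x2n)[a a0 E12] /step /(_ x1n isT)[b b0 E13].
move=> /step /(_ x1n isT)[c c0 E14] /step /(_ x1n isT)[d d0 E16].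
move=> /step /(_ x2n isT)[g g0 E25] /step /(_ isT isT)[f f0 E34].
move=> /step /(_ isT isT)[h h0 E35] /step /(_ x1n isT)[c15 _ E15].
move=> /step /(_ x2n isT)[c24 _ E24].
(* The brackets 15 and 24 vanish, which leaves two terms in the Jacobi sums on 125 and 124; on 134
   one term dies by [e_3, e_3] = 0 after substitution. *)
rewrite {2}/node /= scaler0 in E15; rewrite {2}/node /= scaler0 in E24.
have J125 : g * d - a * h = 0.
  apply: (eq0 1%N) => //; rewrite -[RHS](lie_jacobi brP (e x1) (e x2) (e 3)).
  rewrite E25 (lieC brP (e x1) (e 3)) E15 E12 oppr0 !(lievZ brP, liev0 brP) E16.
  by rewrite (lieC brP (e 5) (e 3)) E35 addr0 scalerN !scalerA scalerBl.
have J134 : f * d - c * h = 0.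
  apply: (eq0 1%N) => //; rewrite -[RHS](lie_jacobi brP (e x1) (e 5) (e 4)).
  rewrite E34 (lieC brP (e x1) (e 4)) E14 E13 -scaleNr !(lievZ brP) E16 E35.
  by rewrite (lie_alternating brP) scaler0 addr0 !scalerA -scalerDl mulNr.
have J124 : c * g + a * f = 0.
  apply: (eq0 2%N) => //; apply: oppr_inj; rewrite oppr0.
  rewrite -[RHS](lie_jacobi brP (e x1) (e x2) (e 4)).
  rewrite E24 (lieC brP (e x1) (e 4)) E14 E12 (liev0 brP) add0r -(scaleNr c) !(lievZ brP) E25.
  by rewrite (lieC brP (e 5) (e 4)) E34 scalerN !scalerA -scaleNr -scalerDl -scaleNr; congr (_ *: _); ring.
have : (2%:R * c * g * d == 0).
  apply/eqP; transitivity (c * (g * d - a * h) - a * (f * d - c * h) + d * (c * g + a * f)).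
    by ring.
  by rewrite J125 J134 J124 !mulr0 subr0 addr0.
by rewrite !mulf_eq0 pnatr_eq0 (negPf c0) (negPf g0) (negPf d0).
Qed.

End Obstruction.

(** * Recovering niceness from a table *)

Section CodedNice.
Variables (R : realType) (V : vectType R) (br : V -> V -> V) (n : nat) (B : n.-tuple V).
Variables (D : seq (seq nat)) (L : seq 'I_n).
Hypotheses (brP : lie_bracket br) (Bb : basis_of fullv B).
Hypotheses (Lperm : perm_eq L (enum 'I_n)) (DL : coding br B D L).
Hypothesis Dinj : forall x y z, (x <= n)%N -> (y <= n)%N -> (z <= n)%N ->
  target D x y = target D x z -> target D x y != 0%N -> y = z.

Lemma coding_nice_basis : nice_basis br B.
Proof.
have step i j : exists2 c, c != 0 & br (tnth B i) (tnth B j) = c *: node B L (target D (pos L i) (pos L j)).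
  by have [_] := DL (pos_le Lperm i) (pos_le Lperm j); rewrite !node_pos.
split=> // i j; have [c c0 cE] := step i j.
  case: (nodeP B Lperm (target D (pos L i) (pos L j))) => [e0 _|k kE].
    by exists i, 0; rewrite cE e0 scaler0 scale0r.
  by exists k, c; rewrite cE kE node_pos.
have lin (a : R) h : linear (fun v => a * coord B h v : R^o).
  by move=> b u v; rewrite linearP mulrDr mulrCA.
have linl : linear (fun v => interior (tnth B i) (chevalley_eilenberg br (coord B j)) v : R^o).
  move=> b u v; rewrite /interior /chevalley_eilenberg (lie_linear_r brP) linearP.
  by rewrite opprD scalerN.
have off k : target D (pos L i) (pos L k) != pos L j -> coord B j (br (tnth B i) (tnth B k)) = 0.
  have [a a0 ->] := step i k; move=> tj; rewrite linearZ /=.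
  case: (nodeP B Lperm (target D (pos L i) (pos L k))) => [-> _|l lE].
    by rewrite linear0 mulr0.
  by rewrite lE node_pos // coord_tnth //; move: tj; rewrite lE (inj_eq (pos_inj Lperm)) eq_sym => /negPf ->; rewrite mulr0.
(* By [Dinj] at most one label leads from e_i to e_j; it supplies the single dual element, and
   without it the interior product is zero. *)
have [/existsP[h /eqP hE]|/existsPn none] :=
  boolP [exists h, target D (pos L i) (pos L h) == pos L j].
  exists h, (- coord B j (br (tnth B i) (tnth B h))).
  apply: (linear_fun_ext Bb linl (lin _ _)) => k.
  rewrite /interior /chevalley_eilenberg coord_tnth //.
  have [<-|hk] := eqVneq h k; first by rewrite mulr1.
  rewrite mulr0 off ?oppr0 //; apply: contra hk => /eqP kE.
  by apply/eqP/(pos_inj Lperm)/(Dinj (x := pos L i)); rewrite ?pos_le // ?hE ?kE.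
exists i, 0; apply: (linear_fun_ext Bb linl (lin _ _)) => k.
by rewrite mul0r /interior /chevalley_eilenberg off ?oppr0.
Qed.

End CodedNice.

(** * The exceptional algebra is nice, nilpotent and unbroken *)

Lemma ltn6_ind (P : nat -> Prop) :
  P 0%N -> P 1%N -> P 2%N -> P 3%N -> P 4%N -> P 5%N -> forall k, (k < 6)%N -> P k.
Proof. by do 6![move=> ?]; do 6?[case=> //]. Qed.

Section ExceptionalBracket.
Variable R : realType.
Local Notation br6 := (@exc_bracket R).
Local Notation B6 := (exc_basis R).

Definition exc_order : seq 'I_6 := [seq inord (6 - x) | x <- iota 1 6].

Lemma perm_exc_order : perm_eq exc_order (enum 'I_6).
Proof.
have memL i : i \in exc_order.
  apply/mapP; exists (6 - i)%N; last by rewrite subKn ?inord_val // ltnW.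
  by rewrite mem_iota /= subn_gt0 ltn_ord /= ltnS leq_subr.
apply: uniq_perm (enum_uniq _) _ => [|i]; last by rewrite memL mem_enum.
by rewrite (uniq_size_uniq (enum_uniq 'I_6)) ?size_enum_ord // => i; rewrite memL mem_enum.
Qed.

Lemma exc_bracket_coord (x y : 'rV[R]_6) k : (k < 6)%N ->
  br6 x y 0 (inord k) = - (exc_d x y)`_k.
Proof. by move=> k6; rewrite mxE inordK. Qed.

Lemma row6P (x y : 'rV[R]_6) :
  (forall k, (k < 6)%N -> x 0 (inord k) = y 0 (inord k)) <-> x = y.
Proof.
split=> [xy|-> //]; apply/rowP => k.
by have := xy k (ltn_ord k); rewrite inord_val.
Qed.

Ltac row6 := apply/row6P; apply: ltn6_ind;
  rewrite ?mxE ?inordK // /exc_d /wedge6 /=.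

Lemma exc_lie : lie_bracket br6.
Proof.
split.
- by move=> y a u v; row6; rewrite ?mxE; ring.
- by move=> y a u v; row6; rewrite ?mxE; ring.
- by move=> x; row6; ring.
- by move=> x y z; row6; rewrite ?exc_bracket_coord // /exc_d /wedge6 /=; ring.
Qed.

Lemma exc_basis_tnth i : tnth B6 i = delta_mx 0 i.
Proof. by rewrite tnth_mktuple. Qed.

Lemma exc_sum (v : 'rV[R]_6) : v = \sum_i v 0 i *: tnth B6 i.
Proof. by rewrite {1}[v]row_sum_delta; apply: eq_bigr => i _; rewrite exc_basis_tnth. Qed.

Lemma exc_basis_basis : basis_of fullv B6.
Proof.
rewrite basisEdim size_tuple dimvf dim_matrix andbT.
apply/subvP => v _; rewrite [v]exc_sum; apply: memv_suml => i _.
by apply/memvZ/memv_span/mem_tnth.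
Qed.

Lemma exc_node x : (x < 6)%N -> node B6 exc_order x.+1 = delta_mx 0 (inord (5 - x)).
Proof.
by move: x; apply: ltn6_ind; rewrite /node /exc_order /= exc_basis_tnth.
Qed.

(** Among the nonzero [e_i, e_j] with i < j only [e_1, e_2] has coefficient 1, as de^3 carries a
    minus sign; the other listed pairs are reversed ones. On vanishing brackets the value -1 is an
    arbitrary nonzero choice. *)
Definition exc_coef (x y : nat) : R :=
  if (x, y) \in [:: (6, 5); (3, 6); (4, 6); (4, 5); (2, 5); (3, 4)]%N then 1 else -1.

Ltac eval_target := match goal with |- context [target ?D ?x ?y] =>
  let z := eval vm_compute in (target D x y) in change (target D x y) with z end.

Lemma node0 (V : vectType R) n (B : n.-tuple V) L : node B L 0 = 0.
Proof. by []. Qed.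

Lemma exc_br x y : (x <= 6)%N -> (y <= 6)%N ->
  br6 (node B6 exc_order x) (node B6 exc_order y) =
  exc_coef x y *: node B6 exc_order (target exceptional_diagram x y).
Proof.
case: x => [|x] x6 y6.
  have -> : target exceptional_diagram 0 y = 0%N by move: y y6; do 7?[case=> //].
  by rewrite (lie0v exc_lie) scaler0.
case: y y6 => [|y] y6.
  have -> : target exceptional_diagram x.+1 0 = 0%N by move: x x6; do 6?[case=> //].
  by rewrite (liev0 exc_lie) scaler0.
rewrite !exc_node //.
move: y y6; apply: ltn6_ind; move: x x6; apply: ltn6_ind;
  rewrite /exc_coef; eval_target; rewrite ?exc_node ?node0 //=;
  apply/row6P; apply: ltn6_ind; rewrite exc_bracket_coord // [RHS]mxE /exc_d /wedge6 /= ?mxE -?val_eqE /= ?inordK //=; ring.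
Qed.


End ExceptionalBracket.

Section ExceptionalNice.
Variable R : realType.
Local Notation br6 := (@exc_bracket R).
Local Notation B6 := (exc_basis R).
Lemma exc_coding : coding br6 B6 exceptional_diagram exc_order.
Proof.
move=> x y x6 y6; split; last first.
  exists (exc_coef R x y); last exact: exc_br.
  by rewrite /exc_coef; case: ifP; rewrite ?oppr_eq0 oner_eq0.
have H : all (fun x => all (fun y => target exceptional_diagram x y <= 6)%N (iota 0 7)) (iota 0 7) by [].
move: (all_iota0 H x6); cbv beta => Hx; exact: (all_iota0 Hx y6).
Qed.

(** Every monomial of the component of [exc_d] at index [i] contains a coordinate of the second
    argument of index below [i], so each bracketing kills one more coordinate. *)
Lemma exc_lower_central k (v : 'rV[R]_6) : v \in lower_central br6 k ->
  forall i, (i < 6)%N -> (i < k)%N -> v 0 (inord i) = 0.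
Proof.
elim: k v => [|k IH] v //= vk i i6 ik.
rewrite /brv in vk; set X := [seq br6 u w | u <- _, w <- _] in vk.
rewrite (@coord_span _ _ _ (in_tuple X) v vk) summxE big1 // => j _; rewrite mxE.
have /allpairsP[[u w] /= [_ /vbasis_mem /IH w0 ->]] : X`_j \in X by apply: mem_nth.
rewrite exc_bracket_coord //.
have {}w0 l : (l < i)%N -> w 0 (inord l) = 0.
  by move=> li; apply: w0; [exact: ltn_trans li i6 | exact: leq_trans li ik].
suff -> : (exc_d u w)`_i = 0 by rewrite oppr0 mulr0.
by move: i i6 w0 {ik}; apply: ltn6_ind => w0; rewrite /exc_d /wedge6 /= ?w0 //; ring.
Qed.

Lemma exc_nilpotent : nilpotent_bracket br6.
Proof.
exists 6; apply/eqP; rewrite -subv0; apply/subvP => v /exc_lower_central v0.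
by rewrite memv0; apply/eqP/row6P => k k6; rewrite v0 // mxE.
Qed.

Lemma exc_nice : nice_nilpotent br6 B6.
Proof.
split; [exact: exc_lie|exact: exc_nilpotent|].
apply: (coding_nice_basis (exc_lie R) (exc_basis_basis R) perm_exc_order exc_coding).
have H : all (fun x => all (fun y => all (fun z =>
    (target exceptional_diagram x y == target exceptional_diagram x z) ==>
    (target exceptional_diagram x y != 0%N) ==> (y == z)) (iota 0 7)) (iota 0 7)) (iota 0 7) by [].
move=> x y z x6 y6 z6 yz y0; apply/eqP.
move: (all_iota0 H x6); cbv beta => Hx; move: (all_iota0 Hx y6); cbv beta => Hy.
by move: (all_iota0 Hy z6); rewrite yz eqxx -yz y0.
Qed.

Lemma exc_not_breaking : ~ exists s, arrow_breaking br6 B6 s.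
Proof.
case=> s /(diagram_of_arrow_breaking exc_nice perm_exc_order exc_coding)[t tp].
by apply/negP/exceptional_unbroken.
Qed.
End ExceptionalNice.

Lemma hom_of_basis (R : realType) (V W : vectType R) n (B : n.-tuple V) (w : 'I_n -> W) :
  basis_of fullv B -> exists f : 'Hom(V, W), forall i, f (tnth B i) = w i.
Proof.
move=> Bb; pose f v := \sum_i coord B i v *: w i.
have flin : linear f.
  move=> a u v; rewrite /f scaler_sumr -big_split /=.
  by apply: eq_bigr => i _; rewrite linearP scalerDl scalerA.
pose F : {linear V -> W} := HB.pack f (GRing.isLinear.Build _ _ _ _ f flin).
exists (linfun F) => i; rewrite lfunE /= /f (bigD1 i) //= coord_tnth // eqxx scale1r.
by rewrite big1 ?addr0 // => k ki; rewrite coord_tnth // (negPf ki) scale0r.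
Qed.

(** * Invariance of arrow-breaking involutions under equivalence *)

Section Transport.
Variables (R : realType) (V W : vectType R) (br : V -> V -> V) (br' : W -> W -> W).
Variables (n n' : nat) (B : n.-tuple V) (B' : n'.-tuple W).

Lemma arrow_breaking_equivalent : basis_of fullv B -> basis_of fullv B' ->
  lie_bracket br' ->
  nice_equivalent br B br' B' ->
  (exists s, arrow_breaking br B s) -> exists s, arrow_breaking br' B' s.
Proof.
move=> Bb Bb' brP' [f [fbij fbr fB]] [s [sK sin sout]].
have /fin_all_exists[j] : forall i, exists j, exists a, f (tnth B i) = a *: tnth B' j by [].
move/fin_all_exists => [a fE].
have finj : injective f by exact: bij_inj.
have a0 i : a i != 0.
  apply: contraNneq (tnth_basis_neq0 Bb i) => ai.
  by apply/eqP/finj; rewrite fE ai scale0r linear0.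
(* Two basis vectors sent to multiples of the same vector would be linearly dependent. *)
have jinj : injective j.
  move=> i k jik; apply/eqP; apply: contraT => ik.
  have E : a k *: tnth B i = a i *: tnth B k.
    by apply: finj; rewrite !linearZ /= !fE jik !scalerA mulrC.
  have := congr1 (coord B i) E; rewrite !linearZ /= !coord_tnth // eqxx (negPf ik) mulr1 mulr0.
  by move/eqP; rewrite (negPf (a0 k)).
(* The lengths [n] and [n'] are not assumed equal; a missed index would give a dual element
   vanishing on the image of the surjective [f]. *)
have jsur k : exists i, j i = k.
  case: (pickP (fun i => j i == k)) => [i /eqP|none]; [by exists i|exfalso].
  have f0 v : coord B' k (f v) = 0.
    rewrite (basis_sum Bb v) linear_sum /= linear_sum big1 // => i _.
    by rewrite !linearZ /= fE linearZ /= coord_tnth // eq_sym none !mulr0.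
  have [g fK gK] := fbij; have := f0 (g (tnth B' k)).
  by rewrite gK coord_tnth // eqxx => /eqP; rewrite oner_eq0.
have [g gK] := fin_all_exists jsur.
have jK i : g (j i) = i by apply: jinj.
have arrowE x y z : arrow br B x y z <-> arrow br' B' (j x) (j y) (j z).
  have brE : a x * a y *: br' (tnth B' (j x)) (tnth B' (j y)) = f (br (tnth B x) (tnth B y)).
    by rewrite fbr !fE (lieZv brP') (lievZ brP') scalerA.
  split=> -[c c0 cE].
    exists ((a x * a y)^-1 * (c * a z)).
      by rewrite !mulf_neq0 ?invr_eq0 ?mulf_neq0.
    have caE : (c * a z) *: tnth B' (j z) = f (c *: tnth B z).
      by rewrite linearZ /= fE scalerA.
    by rewrite -scalerA caE -cE -brE scalerK ?mulf_neq0.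
  exists (a x * a y * c / a z); first by rewrite !mulf_neq0 ?invr_eq0.
  by apply: finj; rewrite linearZ /= -brE cE fE !scalerA divfK.
have inE x y : has_incoming br B x y <-> has_incoming br' B' (j x) (j y).
  by split=> -[w H]; [exists (j w); apply/arrowE|exists (g w); apply/arrowE; rewrite gK].
have outE x y : has_outgoing br B x y <-> has_outgoing br' B' (j x) (j y).
  by split=> -[w H]; [exists (j w); apply/arrowE|exists (g w); apply/arrowE; rewrite gK].
(* The involution is conjugated by the bijection [j], which preserves arrows. *)
pose t k := j (s (g k)).
have tK : involutive t by move=> k; rewrite /t jK sK gK.
exists (perm (inv_inj tK)); split.
- by move=> k; rewrite !permE.
- move=> x y; rewrite !permE -{1}[x]gK -{1}[y]gK => /inE /sin K /inE; exact: K.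
- move=> x y; rewrite !permE -{1}[x]gK -{1}[y]gK => /outE /sout K /outE; exact: K.
Qed.
End Transport.

(** * Equivalence of all algebras with the exceptional diagram *)

Section Uniqueness.
Variables (R : realType) (V : vectType R) (br : V -> V -> V) (B : 6.-tuple V).
Hypothesis nn : nice_nilpotent br B.

Let brP := nn_lie nn.
Let Bb := nice_is_basis (nn_nice nn).
Local Notation br6 := (@exc_bracket R).
Local Notation B6 := (exc_basis R).
Local Notation e6 := (node B6 exc_order).

(** Exchanging the last two entries of [L] renumbers nodes 5 and 6; all targets are at most 4 and
    hence unaffected. *)
Lemma swapped_coding L : perm_eq L (enum 'I_6) ->
  coding br B exceptional_diagram_swapped L ->
  exists2 L', perm_eq L' (enum 'I_6) & coding br B exceptional_diagram L'.
Proof.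
move=> Lperm; have := size_order Lperm.
case: L Lperm => [|a1 [|a2 [|a3 [|a4 [|a5 [|a6 [|]]]]]]] // Lperm _ H.
pose s x : nat := nth 0 [:: 0; 1; 2; 3; 4; 6; 5]%N x.
exists [:: a1; a2; a3; a4; a6; a5].
  apply: perm_trans Lperm; do 4!rewrite perm_cons; exact: permEl (perm_catC [:: a6] [:: a5]).
have nodeE x : (x <= 6)%N ->
    node B [:: a1; a2; a3; a4; a6; a5] x = node B [:: a1; a2; a3; a4; a5; a6] (s x).
  by case: x => // x; move: x; apply: ltn6_ind.
have small x : (x <= 6)%N -> (s x <= 6)%N.
  by case: x => // x; move: x; apply: ltn6_ind.
have tE x y : (x <= 6)%N -> (y <= 6)%N ->
    (target exceptional_diagram x y <= 4)%N /\
    target exceptional_diagram x y = target exceptional_diagram_swapped (s x) (s y).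
  have : all (fun x => all (fun y => (target exceptional_diagram x y <= 4)%N &&
      (target exceptional_diagram x y == target exceptional_diagram_swapped (s x) (s y)))
      (iota 0 7)) (iota 0 7) by [].
  by move=> /all_iota0 K x6 y6; move: (K x x6); cbv beta => Kx; have /andP[? /eqP] := all_iota0 Kx y6.
move=> x y x6 y6; have [t4 tE'] := tE x y x6 y6.
split; first exact: leq_trans t4 _.
have [_ [c c0 cE]] := H _ _ (small x x6) (small y y6); exists c => //.
rewrite !nodeE // ?(leq_trans t4) // cE -tE'; congr (_ *: node _ _ _).
by move: t4; case: (target _ _ _) => [|[|[|[|[|]]]]].
Qed.

Lemma exceptional_equivalent L : perm_eq L (enum 'I_6) ->
  coding br B exceptional_diagram L -> nice_equivalent br B br6 B6.
Proof.
move=> Lperm LD; pose e := node B L.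
have step x y z : (x <= 6)%N -> (y <= 6)%N -> target exceptional_diagram x y = z ->
    exists2 c : R, c != 0 & br (e x) (e y) = c *: e z.
  by move=> xn yn <-; have [_] := LD x y xn yn.
have [a a0 E12] := step 6%N 5%N 4%N isT isT erefl; have [b b0 E13] := step 6%N 4%N 3%N isT isT erefl.
have [c c0 E14] := step 6%N 3%N 2%N isT isT erefl; have [d d0 E23] := step 5%N 4%N 2%N isT isT erefl.
have [g g0 E25] := step 5%N 2%N 1%N isT isT erefl; have [f f0 E34] := step 4%N 3%N 1%N isT isT erefl.
(* The Jacobi identity on e_1, e_2, e_4, where [e_2, e_4] = 0. *)
have fE : f = - (c * g) / a.
  have [c24 _ E24] := step 5%N 3%N 0%N isT isT erefl; rewrite [e 0%N]/(0 : V) scaler0 in E24.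
  have := lie_jacobi brP (e 6%N) (e 5%N) (e 3%N).
  rewrite E24 (lieC brP (e 6%N) (e 3%N)) E14 E12 (liev0 brP) add0r -scaleNr !(lievZ brP) E25.
  rewrite (lieC brP (e 4%N) (e 3%N)) E34 scalerN !scalerA -scaleNr -scalerDl.
  move/(congr1 (node_coord B L 1%N)); rewrite node_coord0 node_coordZ // node_coord_node //= mulr1.
  by move=> h; apply: (mulIf a0); rewrite divfK // -[RHS]addr0 -[X in _ + X]oppr0 -h; ring.
(* With e_1 scaled by 1 and e_2 by t, the brackets 12, 13, 14, 25 determine the
   other scalars; the bracket 23 then determines t, and the bracket 34 is
   normalized by the Jacobi relation on f. *)
pose t := - d / (b * c).
pose lam (x : nat) : R := nth 0
  [:: 0; - t ^+ 2 / (a * b * c * g); t / (a * b * c); - t / (a * b); t / a; t; 1] x.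
have lam0 x : (x < 6)%N -> lam x.+1 != 0.
  by move: x; apply: ltn6_ind; rewrite /lam /= ?(mulf_eq0, invr_eq0, oppr_eq0, expf_eq0, oner_eq0, negb_or) ?d0 ?a0 ?b0 ?c0 ?g0.
have [F FE] := hom_of_basis (fun i => lam (pos L i) *: e6 (pos L i)) Bb.
have [G GE] := hom_of_basis (fun i => (lam (pos exc_order i))^-1 *: e (pos exc_order i)) (exc_basis_basis R).
have Fe x : (x <= 6)%N -> F (e x) = lam x *: e6 x.
  move=> x6; case: (nodeP B Lperm x) => [E [->|]|i ->]; first by rewrite /e /node /= linear0 scaler0.
    by rewrite ltnNge x6.
  by rewrite /e node_pos.
have Ge x : (x < 6)%N -> G (e6 x.+1) = (lam x.+1)^-1 *: e x.+1.
  move=> x6; case: (nodeP B6 perm_exc_order x.+1) => [_ [//|]|i ->]; first by rewrite ltnNge x6.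
  by rewrite node_pos ?perm_exc_order.
have FK : cancel F G.
  apply: (linear_fun_ext Bb (g := G \o F) (h := id)) => // [u v w|i].
    by rewrite /= !linearP.
  have p6 := pos_le Lperm i; rewrite /= FE linearZ /= Ge ?scalerA ?mulfV ?scale1r ?lam0 //.
  exact: node_pos.
have GK : cancel G F.
  apply: (linear_fun_ext (exc_basis_basis R) (g := F \o G) (h := id)) => // [u v w|i].
    by rewrite /= !linearP.
  have p6 := pos_le perm_exc_order i; rewrite /= GE linearZ /= Fe // scalerA mulVf ?scale1r ?lam0 //.
  exact: (node_pos _ perm_exc_order).
exists F; split; first by exists G.
  (* Compatibility with brackets is checked on pairs of nodes: six arrows up to antisymmetry, and
     the vanishing brackets. *)
  pose P x y := F (br (e x) (e y)) = br6 (F (e x)) (F (e y)).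
  have Psym x y : P x y -> P y x.
    by rewrite /P => Pxy; rewrite (lieC brP (e x)) (lieC (exc_lie R) (F (e x))) linearN /= Pxy.
  have Pzero x y : (x <= 6)%N -> (y <= 6)%N -> target exceptional_diagram x y = 0%N -> P x y.
    move=> x6 y6 t00; have [c1 _] := step x y 0%N x6 y6 t00.
    rewrite /P => ->; rewrite !Fe // (lieZv (exc_lie R)) (lievZ (exc_lie R)) exc_br // t00.
    by rewrite !linearZ /= {1}/e /node /= linear0 !scaler0.
  have Pone x y z c1 : (x <= 6)%N -> (y <= 6)%N -> target exceptional_diagram x y = z ->
      br (e x) (e y) = c1 *: e z -> (z <= 6)%N -> c1 * lam z = lam x * lam y * exc_coef R x y -> P x y.
    move=> x6 y6 tz brE z6 E; rewrite /P brE linearZ /= !Fe //.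
    by rewrite (lieZv (exc_lie R)) (lievZ (exc_lie R)) exc_br // tz !scalerA E.
  have P12 : P 6%N 5%N by apply: (Pone _ _ 4%N a) => //; rewrite /lam /exc_coef /=; field.
  have P13 : P 6%N 4%N by apply: (Pone _ _ 3%N b) => //; rewrite /lam /exc_coef /=; field; rewrite a0 b0.
  have P14 : P 6%N 3%N by apply: (Pone _ _ 2%N c) => //; rewrite /lam /exc_coef /=; field; rewrite a0 b0 c0.
  have P23 : P 5%N 4%N by apply: (Pone _ _ 2%N d) => //; rewrite /lam /exc_coef /= /t; field; rewrite a0 b0 c0.
  have P25 : P 5%N 2%N by apply: (Pone _ _ 1%N g) => //; rewrite /lam /exc_coef /=; field; rewrite a0 b0 c0 g0.
  have P34 : P 4%N 3%N by apply: (Pone _ _ 1%N f) => //; rewrite /lam /exc_coef /= fE; field; rewrite a0 b0 c0 g0.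
  have PP x y : (x < 6)%N -> (y < 6)%N -> P x.+1 y.+1.
    move=> x6 y6; move: y y6; apply: ltn6_ind; move: x x6; apply: ltn6_ind;
    by [apply: Pzero|apply: P12|apply: P13|apply: P14|apply: P23|apply: P25|apply: P34|apply/Psym].
  apply: (bilinear_fun_ext Bb (g := fun x y => F (br x y)) (h := fun x y => br6 (F x) (F y))).
  - by move=> y k u v; rewrite (lie_linear_l brP) linearP.
  - by move=> x k u v; rewrite (lie_linear_r brP) linearP.
  - by move=> y k u v; rewrite linearP (lie_linear_l (exc_lie R)).
  - by move=> x k u v; rewrite linearP (lie_linear_r (exc_lie R)).
  - move=> i j; rewrite -!(node_pos B Lperm); apply: (PP (index i L) (index j L)).
      exact: (pos_le Lperm).
    exact: (pos_le Lperm).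
move=> i; case: (nodeP B6 perm_exc_order (pos L i)) => [_ [//|]|j jE].
  by rewrite ltnNge pos_le.
by exists j, (lam (pos L i)); rewrite FE jE node_pos ?perm_exc_order.
Qed.

End Uniqueness.

(** * Classification in dimension at most 7 *)

Theorem proposition5p4 (R : realType) :
  [/\ nice_nilpotent (@exc_bracket R) (exc_basis R),
      ~ (exists s : {perm 'I_6},
           arrow_breaking (@exc_bracket R) (exc_basis R) s)
    & forall (V : vectType R) (br : V -> V -> V) (n : nat) (B : n.-tuple V),
        nice_nilpotent br B -> (\dim {:V} <= 7)%N ->
        (exists s : {perm 'I_n}, arrow_breaking br B s) <->
        ~ nice_equivalent br B (@exc_bracket R) (exc_basis R)].
Proof.
split; [exact: exc_nice|exact: exc_not_breaking|].
move=> V br n B nn dim7; have Bb := nice_is_basis (nn_nice nn).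
have n7 : (n <= 7)%N by rewrite (size_basis Bb) in dim7.
split=> [sB eqB|neqB].
  apply: (@exc_not_breaking R).
  exact: arrow_breaking_equivalent Bb (exc_basis_basis R) (exc_lie R) eqB sB.
have [L [m [Lperm mP LD]]] := nice_coding nn.
(* The table of the algebra occurs in the enumeration, so it has a candidate involution, is
   exceptional, or violates the Jacobi identity. *)
have := allP (diagrams_settled n7) _ (diagrams_complete mP n.+1).
case/or3P=> [/hasP[s sc /andP[so si]]|/andP[/eqP n6 Dexc]|/andP[/eqP n7' Dobs]].
- apply: (arrow_breaking_of_diagram nn Lperm LD (s := s)).
  by rewrite /diagram_breaking so si (allP (candidates_involutive n7)).
- move: (table _ _) LD Dexc => D; subst n; rewrite !inE => LD /orP[] /eqP DE; subst D.
    by case: neqB; apply: exceptional_equivalent Lperm LD.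
  have [L' L'perm L'D] := swapped_coding Lperm LD.
  by case: neqB; apply: exceptional_equivalent L'perm L'D.
- exfalso; move: (table _ _) LD Dobs => D; subst n => LD /orP[].
    by apply/negP/(obstructed_false nn Lperm LD).
  by apply/negP/(obstructed_false nn Lperm LD).
Qed.
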